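(* Let $k\ge 1$ and let $T$ be a totally ordered tree with all leaves at depth $k$. There is a logically valid formula $\Phi$ of the form $$\Phi=\forall y_0\,\exists x_1\,\forall y_1\cdots\forall y_{k-1}\,\exists x_k\,\forall y_k\,\exists \vec z\;\varphi^*$$ with $\varphi^*$ quantifier-free, such that the following hold. (a) There is a depth $k+1$ Herbrand game tree $T^*$ for $\Phi$ which consists of $T$ plus one additional edge below each leaf node of $T$ (for Student's plays of values for the last block $\exists\vec z$), such that Student has a winning strategy $S$ on $T^*$. Furthermore, this strategy $S$ is copycat (on all edges other than the additional bottommost edges). (b) Vice versa, suppose that $S'$ is a winning strategy for Student (not necessarily a copycat strategy) for $\Phi$ on a Herbrand game tree $T'$. Then there is an embedding $\tau$ of $T$ into $T'$ such that the strategy $S'$, when restricted to the subtree $\tau(T)$, is identical to $S$ except for the bottom part; that is, writing $u_0\prec u_1\prec\cdots$ for the nodes of $T$, for every non-root node $u_i$ of $T$ the label assigned by $S'$ to the edge of $T'$ ending in $\tau(u_i)$ is the variable labeling $\tau(u_{i-1})$ (so the restriction of $S'$ is $S$ up to the names of Teacher's variables).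
   Context: All trees are finite and rooted. First-order logic is considered without equality; ''tautology'' means propositional tautology. **Totally ordered tree.** A tree with a total order $\prec$ on the set of all its nodes such that $u\prec v$ whenever $v$ is a child of $u$. Its nodes are enumerated $u_0\prec u_1\prec\cdots\prec u_{n-1}$ ($u_0$ is the root), and the order is extended to edges by $u_0\prec e_1\prec u_1\prec e_2\prec u_2\prec\cdots\prec e_{n-1}\prec u_{n-1}$, where $e_i$ is the edge joining $u_i$ to its parent. **Embedding.** An embedding of a totally ordered tree $S$ into a totally ordered tree $T$ is an injective map $\tau$ from the nodes of $S$ to the nodes of $T$ such that $\tau$ maps the root to the root; $u\prec_S v$ iff $\tau(u)\prec_T\tau(v)$; and $u$ is a child of $v$ in $S$ iff $\tau(u)$ is a child of $\tau(v)$ in $T$. **Herbrand game tree for a formula $\Phi$ whose prefix is $\forall y_0\exists x_1\forall y_1\cdots\exists x_k\forall y_k\exists\vec z$.** A labeled totally ordered tree of depth $k+1$ with all branches of length $k+1$, in which (1) the nodes at depth at most $k$ are labeled by distinct free variables (Teacher's moves), while the leaves (at depth $k+1$) are unlabeled; (2) each edge ending at a node of depth at most $k$ is labeled by a term of the language, and each bottommost edge is labeled by a vector of terms of the same length as $\vec z$ (Student's moves), where a term labeling an edge $e$ may contain only free variables that label nodes preceding $e$ in $\prec$; (3) for every node, its outgoing edges have different labels; (4) all leaves succeed all internal nodes in $\prec$. **Strategy, winning strategy.** Given the tree with its order and node variables, a strategy for Student is a labeling of the edges satisfying these conditions. It is winning for $\Phi$ if the disjunction, over all branches $b$ of the tree,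 of the instances of the quantifier-free matrix of $\Phi$ obtained by substituting for $y_0,x_1,y_1,\dots,x_k,y_k,\vec z$ the successive labels of nodes and edges along $b$ from root to leaf, is a tautology. **Copycat.** A strategy is copycat if Student always plays the variable most recently played by Teacher: for each $i\ge 1$, the edge $e_i$ is labeled by the variable labeling $u_{i-1}$. For a prefix ending in $\exists\vec z$, this is required only for edges other than the bottommost ones. In $T^*$ the order $\prec$ extends that of $T$, the newly added leaves following all nodes of $T$. *)

(* Defs.v *)
From mathcomp Require Import all_boot.

Set Implicit Arguments.
Unset Strict Implicit.
Unset Printing Implicit Defensive.

(* The language has countably many function and predicate symbols of every
   arity: [Fun n i] and [Rel n i] use the [i]-th symbol of arity [n].  The
   type [(A ^ n)%type] is [{ffun 'I_n -> A}]. *)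
Inductive term : Type :=
  | Var of nat
  | Fun (n i : nat) of (term ^ n)%type.

Inductive atom : Type :=
  | Rel (n i : nat) of (term ^ n)%type.

Inductive qform : Type :=
  | QFalse
  | QAtom of atom
  | QNot of qform
  | QAnd of qform & qform
  | QOr of qform & qform
  | QImp of qform & qform.

Inductive prenex : Type :=
  | Matrix of qform
  | All (x : nat) of prenex
  | Ex (x : nat) of prenex.

Fixpoint occurs (x : nat) (t : term) : bool :=
  match t with
  | Var y => x == y
  | Fun n i a => [exists j, occurs x (a j)]
  end.

Definition aoccurs (x : nat) (a : atom) : bool :=
  let: Rel n i args := a in [exists j, occurs x (args j)].

Fixpoint qoccurs (x : nat) (q : qform) : bool :=
  match q with
  | QFalse => false
  | QAtom a => aoccurs x a
  | QNot q1 => qoccurs x q1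
  | QAnd q1 q2 | QOr q1 q2 | QImp q1 q2 => qoccurs x q1 || qoccurs x q2
  end.

Fixpoint tsubst (s : nat -> term) (t : term) : term :=
  match t with
  | Var x => s x
  | Fun n i a => Fun i [ffun j => tsubst s (a j)]
  end.

Definition asubst (s : nat -> term) (a : atom) : atom :=
  let: Rel n i args := a in Rel i [ffun j => tsubst s (args j)].

Fixpoint qsubst (s : nat -> term) (q : qform) : qform :=
  match q with
  | QFalse => QFalse
  | QAtom a => QAtom (asubst s a)
  | QNot q1 => QNot (qsubst s q1)
  | QAnd q1 q2 => QAnd (qsubst s q1) (qsubst s q2)
  | QOr q1 q2 => QOr (qsubst s q1) (qsubst s q2)
  | QImp q1 q2 => QImp (qsubst s q1) (qsubst s q2)
  end.

Fixpoint qeval (v : atom -> bool) (q : qform) : bool :=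
  match q with
  | QFalse => false
  | QAtom a => v a
  | QNot q1 => ~~ qeval v q1
  | QAnd q1 q2 => qeval v q1 && qeval v q2
  | QOr q1 q2 => qeval v q1 || qeval v q2
  | QImp q1 q2 => qeval v q1 ==> qeval v q2
  end.

Definition tautology (q : qform) : Prop := forall v : atom -> bool, qeval v q.

Definition disjunction (s : seq qform) : qform := foldr QOr QFalse s.

Record model : Type := Model {
  domain : Type;
  fun_interp : forall n : nat, nat -> (domain ^ n)%type -> domain;
  rel_interp : forall n : nat, nat -> (domain ^ n)%type -> bool
}.

Fixpoint teval (M : model) (e : nat -> domain M) (t : term) : domain M :=
  match t with
  | Var x => e x
  | Fun n i a => fun_interp i [ffun j => teval e (a j)]
  end.

Definition aeval (M : model) (e : nat -> domain M) (a : atom) : bool :=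
  let: Rel n i args := a in rel_interp i [ffun j => teval e (args j)].

Definition update (A : Type) (e : nat -> A) (x : nat) (d : A) : nat -> A :=
  fun y => if y == x then d else e y.

Fixpoint sat (M : model) (e : nat -> domain M) (F : prenex) : Prop :=
  match F with
  | Matrix q => qeval (aeval e) q
  | All x F1 => forall d : domain M, sat (update e x d) F1
  | Ex x F1 => exists d : domain M, sat (update e x d) F1
  end.

(* The existence of an assignment [e] makes the domain nonempty. *)
Definition valid (F : prenex) : Prop :=
  forall (M : model) (e : nat -> domain M), sat e F.

(* Bound variables are numbered by their position in the prefix: y_i is
   variable [2 i], x_i is variable [2 i - 1], and z_1, ..., z_m are the
   variables [2 k + 1], ..., [2 k + m]. *)
Definition quantify (x : nat) (F : prenex) : prenex :=
  if odd x then Ex x F else All x F.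

Definition game_formula (k m : nat) (phi : qform) : prenex :=
  foldr quantify (foldr Ex (Matrix phi) (iota k.*2.+1 m)) (iota 0 k.*2.+1).

Definition matrix_closed (k m : nat) (phi : qform) : Prop :=
  forall x, qoccurs x phi -> x < k.*2.+1 + m.

(* The node u_i of the enumeration u_0 < u_1 < ... of the tree is the ordinal
   [i], so that the total order is the order of ['I_nedges.+1] and u_0 is the
   root.  The edge e_i is represented by its lower endpoint u_i. *)
Record totree : Type := TOTree {
  nedges : nat;
  parent : 'I_nedges.+1 -> option 'I_nedges.+1;
  parent_root : forall v, (parent v == None) = (v == ord0);
  parent_lt : forall u v, parent v = Some u -> u < v
}.

Definition node (T : totree) : finType := 'I_(nedges T).+1.

Definition root (T : totree) : node T := ord0.

Definition child (T : totree) (v u : node T) : bool := parent v == Some u.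

Definition leaf (T : totree) (u : node T) : bool := ~~ [exists v, child v u].

(* The non-root nodes on the path from the root to [v]. *)
Fixpoint path_rec (T : totree) (fuel : nat) (v : node T) : seq (node T) :=
  if fuel is f.+1 then
    if parent v is Some u then rcons (path_rec f u) v else [::]
  else [::].

Definition path_to (T : totree) (v : node T) : seq (node T) :=
  path_rec (nedges T) v.

(* The fuel is sufficient. *)
Lemma path_toE (T : totree) (v : node T) :
  path_to v = if parent v is Some u then rcons (path_to u) v else [::].
Proof.
have fuelP f g (w : node T) : w <= f -> w <= g -> path_rec f w = path_rec g w.
  elim: f g w => [|f IHf] [|g] w //= wf wg.
  - case E: (parent w) => [u|] //; have := leq_trans (parent_lt E) wf.
    by rewrite ltn0.
  - case E: (parent w) => [u|] //; have := leq_trans (parent_lt E) wg.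
    by rewrite ltn0.
  - case E: (parent w) => [u|] //; have uw := parent_lt E.
    by rewrite (IHf g) // -ltnS; apply: leq_trans uw _.
have vT : v <= nedges T by rewrite -ltnS ltn_ord.
rewrite {1}/path_to (fuelP _ (nedges T).+1 v) ?leqW //=.
Qed.

Definition depth (T : totree) (v : node T) : nat := size (path_to v).

Definition leaves_at_depth (T : totree) (k : nat) : Prop :=
  forall v : node T, leaf v -> depth v = k.

Definition embedding (S T : totree) (tau : node S -> node T) : Prop :=
  [/\ injective tau,
      tau (root S) = root T,
      forall u v : node S, (u < v) = (tau u < tau v)
    & forall u v : node S, child u v = child (tau u) (tau v)].

(* [Ts] is [T] with one new leaf attached below each leaf of [T], all the new
   leaves following the nodes of [T]. *)
Definition adds_leaf_edges (T Ts : totree) : Prop :=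
  exists iota : node T -> node Ts,
    [/\ embedding iota,
        forall l : node T, leaf l -> exists! w : node Ts, child w (iota l),
        forall w : node Ts, (forall u, iota u <> w) ->
          exists2 l : node T, leaf l & child w (iota l)
      & forall w : node Ts, (forall u, iota u <> w) ->
          forall u : node T, iota u < w].

(* Teacher's variable at an internal node [u] is [y u]; the values of [y] at
   leaves are never used. *)
Definition game_tree (k : nat) (T : totree) (y : node T -> nat) : Prop :=
  [/\ leaves_at_depth T k.+1,
      forall u v : node T, ~~ leaf u -> ~~ leaf v -> y u = y v -> u = v
    & forall u l : node T, ~~ leaf u -> leaf l -> u < l].

(* [move S v] labels the edge ending at an internal non-root node [v], and
   [final S v] the bottommost edge ending at a leaf [v]; the other values of
   these functions are never used. *)
Record labeling (T : totree) (m : nat) : Type := Labeling {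
  move : node T -> term;
  final : node T -> m.-tuple term
}.

(* In the order on nodes and edges, u_j precedes e_i iff j < i. *)
Definition allowed (T : totree) (y : node T -> nat) (v : node T) (t : term) : Prop :=
  forall x, occurs x t -> exists u : node T, [/\ u < v, ~~ leaf u & y u = x].

Definition strategy (T : totree) (m : nat) (y : node T -> nat)
    (S : labeling T m) : Prop :=
  [/\ forall v, ~~ leaf v -> v <> root T -> allowed y v (move S v),
      forall v, leaf v -> forall j, allowed y v (tnth (final S v) j),
      forall u v w, child v u -> child w u -> v <> w ->
        ~~ leaf v -> ~~ leaf w -> move S v <> move S w
    & forall u v w, child v u -> child w u -> v <> w ->
        leaf v -> leaf w -> final S v <> final S w].

(* The labels along the branch ending at the leaf [l]. *)
Definition play (T : totree) (m : nat) (y : node T -> nat)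
    (S : labeling T m) (l : node T) : seq term :=
  Var (y (root T))
    :: flatten [seq [:: move S v; Var (y v)] | v <- path_to l & ~~ leaf v]
    ++ final S l.

Definition instance (T : totree) (m : nat) (y : node T -> nat)
    (S : labeling T m)
    (phi : qform) (l : node T) : qform :=
  qsubst (fun x => nth (Var x) (play y S l) x) phi.

Definition winning (T : totree) (m : nat) (y : node T -> nat)
    (S : labeling T m) (phi : qform) : Prop :=
  tautology (disjunction [seq instance y S phi l | l <- enum (@leaf T)]).

Definition copycat (T : totree) (m : nat) (y : node T -> nat)
    (S : labeling T m) : Prop :=
  forall u v : node T, v = u.+1 :> nat -> ~~ leaf v -> move S v = Var (y u).

(* Main.v *)
(* Let Q_j be a predicate saying that Teacher answered a_0, ..., a_j at the first
   j+1 nodes of T in a copycat play.  The matrix phi* is falsified when Q_0 holds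
   of Teacher's first move, when for every non-root node u_j of depth d, with
   parent u_p, Q_{j-1}(.., a_p, .., a_{j-1}) implies Q_j(.., a_p, .., a_{j-1}, a_j)
   whenever y_{d-1} = a_p, x_d = a_{j-1} and y_d = a_j, and when Q_n fails for
   every sequence; here z is the sequence of the other answers.  Equality is not
   available, so y_{d-1}, x_d and y_d are themselves put in the argument places.
   In copycat play one of these requirements breaks at the first node u_j at which
   Q_j fails, or at Q_n.  This gives both (a), propositionally, and the validity,
   in every model.
   For (b), interpret Q_j(t_0, .., t_j) as: the t_i are Teacher's variables at the
   image of a copycat embedding of u_0, .., u_j into T'.  A winning strategy must
   have a branch satisfying phi* under this valuation, and Q_0 and the
   implications are preserved: as Teacher's variables are distinct, y_{d-1} and
   x_d determine the nodes of T', so that the embedding can be extended by the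
   node of depth d of the branch.  Hence Q_n is true of some sequence. *)
From Stdlib Require Import Classical FunctionalExtensionality.
From mathcomp Require Import all_boot.
Require Import Defs.

Set Implicit Arguments.
Unset Strict Implicit.
Unset Printing Implicit Defensive.

(** * Paths, depths and leaves of ordered trees *)

Lemma path_to_path (T : totree) (v : node T) :
  path (fun u w => child w u) (root T) (path_to v) /\
  last (root T) (path_to v) = v.
Proof.
have [n] := ubnP (v : nat); elim: n v => // n IHn v vn.
rewrite path_toE; case E: (parent v) => [u|] /=.
  have [|pu lu] := IHn u; first exact: leq_trans (parent_lt E) vn.
  by rewrite rcons_path last_rcons pu lu /child E eqxx.
by split=> //; apply/esym/eqP; rewrite -parent_root E.
Qed.

Lemma path_to_rcons (T : totree) (u v : node T) :
  parent v = Some u -> path_to v = rcons (path_to u) v.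
Proof. by move=> E; rewrite path_toE E. Qed.

Lemma depth_child (T : totree) (u v : node T) :
  parent v = Some u -> depth v = (depth u).+1.
Proof. by move=> E; rewrite /depth (path_to_rcons E) size_rcons. Qed.

Lemma path_to_root (T : totree) : path_to (root T) = [::].
Proof.
by rewrite path_toE; have /eqP-> : parent (root T) == None by rewrite parent_root.
Qed.

Lemma path_to_leq (T : totree) (v w : node T) : w \in path_to v -> w <= v.
Proof.
have [n] := ubnP (v : nat); elim: n v => // n IHn v vn.
rewrite path_toE; case E: (parent v) => [u|] //.
have uv := parent_lt E; rewrite mem_rcons inE => /predU1P[-> //|wu].
by apply: leq_trans (ltnW uv); apply: IHn wu; apply: leq_trans uv vn.
Qed.

(** Among the nodes whose path extends that of [v], the one latest in the order is a leaf: a child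
    of it would come later and still extend the path. *)
Lemma leaf_below (T : totree) (v : node T) :
  exists2 l, leaf l & prefix (path_to v) (path_to l).
Proof.
pose P (w : node T) := prefix (path_to v) (path_to w).
have Pv : P v by apply: prefix_refl.
case: (@arg_maxnP _ v P (fun w => w : nat) Pv) => l Pl maxl.
exists l => //; apply/existsP => -[c /eqP cl].
have /maxl : P c by apply: prefix_trans Pl _; rewrite (path_to_rcons cl) prefix_rcons.
by rewrite /= leqNgt (parent_lt cl).
Qed.

(** * Alternating sequences of edge and node labels along a path *)

Definition moves (A B : Type) (f g : A -> B) (s : seq A) : seq B :=
  flatten [seq [:: f w; g w] | w <- s].

Lemma size_moves (A B : Type) (f g : A -> B) s :
  size (moves f g s) = (size s).*2.
Proof. by elim: s => //= w s IHs; rewrite /moves /= IHs. Qed.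

Lemma moves_rcons (A B : Type) (f g : A -> B) s w :
  moves f g (rcons s w) = moves f g s ++ [:: f w; g w].
Proof. by rewrite /moves map_rcons flatten_rcons. Qed.

Lemma nth_moves_even (A B : Type) (f g : A -> B) (s : seq A) (r : seq B) b0 a0 i :
  i < size s -> nth b0 (moves f g s ++ r) i.*2 = f (nth a0 s i).
Proof. by elim: s i => [|w s IHs] [|i] //= /IHs. Qed.

Lemma nth_moves_odd (A B : Type) (f g : A -> B) (s : seq A) (r : seq B) b0 a0 i :
  i < size s -> nth b0 (moves f g s ++ r) i.*2.+1 = g (nth a0 s i).
Proof. by elim: s i => [|w s IHs] [|i] //= /IHs. Qed.

(** * The matrix of the formula *)

Definition relvars (n j : nat) (f : nat -> nat) : qform :=
  QAtom (@Rel n j [ffun i : 'I_n => Var (f i)]).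

Definition zvar (k i : nat) : nat := k.*2.+1 + i.

(* Arguments of the predicate symbol number [j]: the first [j.+1] are
   Teacher's answers at u_0, ..., u_j, and the last one, in position
   [(nedges T).+1], is the answer at u_j again.  It is repeated because the
   parent of u_{j+1} may be u_j itself, and then y_{d-1} and x_d have to be
   compared with the same answer. *)
Definition state (T : totree) (j : nat) (f : nat -> nat) (x : nat) : qform :=
  relvars (nedges T).+2 j (update f (nedges T).+1 x).

Arguments relvars : simpl never.
Arguments state : simpl never.

(** The negation of the requirement attached to [v]. With d the depth of a non-root [v], the numbers
    [(depth u).*2], [(depth u).*2.+1] and [(depth v).*2] are those of y_{d-1}, x_d and y_d. In the
    premise x_d takes the repeated last place; in the conclusion y_d takes both the place of [v] and
    the last one. *)
Definition clause (k : nat) (T : totree) (v : node T) : qform :=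
  if parent v is Some u then
    let f := update (zvar k) u (depth u).*2 in
    QAnd (state T v.-1 f (depth u).*2.+1)
         (QNot (state T v (update f v (depth v).*2) (depth v).*2))
  else QNot (state T 0 (update (zvar k) 0 0) 0).

Definition copycat_matrix (k : nat) (T : totree) : qform :=
  QOr (relvars (nedges T).+2 (nedges T) (zvar k))
      (disjunction [seq clause k v | v <- enum (node T)]).

(** * Evaluation of the matrix, propositionally and in models *)

Lemma qeval_disjunction (A : finType) (P : pred A) (f : A -> qform) (V : atom -> bool) :
  qeval V (disjunction [seq f v | v <- enum P]) = [exists v in P, qeval V (f v)].
Proof.
have -> s : qeval V (disjunction s) = has (qeval V) s.
  by elim: s => //= q s ->.
rewrite has_map; apply/hasP/existsP => [[v]|[v /andP[Pv fv]]].
  by rewrite mem_enum => Pv fv; exists v; apply/andP.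
by exists v; rewrite ?mem_enum.
Qed.

Lemma qeval_copycat_matrix (k : nat) (T : totree) (V : atom -> bool) :
  qeval V (copycat_matrix k T) =
  qeval V (relvars (nedges T).+2 (nedges T) (zvar k)) ||
  [exists v : node T, qeval V (clause k v)].
Proof.
congr orb.
transitivity (qeval V (disjunction [seq clause k v | v <- enum (node T)])); first by [].
rewrite qeval_disjunction.
by apply: eq_existsb.
Qed.

(** The Herbrand structure of [V]: evaluating a substitution instance under [V] amounts to
    evaluating the formula here, with the substitution as assignment. One semantic argument thus
    also covers tautologies. *)
Definition term_model (V : atom -> bool) : model :=
  @Model term (fun n i a => Fun i a) (fun n i a => V (Rel i a)).

Lemma teval_term_model (V : atom -> bool) (s : nat -> term) (t : term) :
  teval (M := term_model V) s t = tsubst s t.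
Proof.
(* The arguments of a term sit inside a finite function, hence the explicit structural recursion. *)
move: t; fix IHt 1 => -[x|n i a] //=.
by congr Fun; apply/ffunP => j; rewrite !ffunE; apply: IHt.
Qed.

Lemma qeval_qsubst (V : atom -> bool) (s : nat -> term) (q : qform) :
  qeval V (qsubst s q) = qeval (aeval (M := term_model V) s) q.
Proof.
elim: q => //= [[n i a]|q ->|q1 -> q2 ->|q1 -> q2 ->|q1 -> q2 ->] //=.
by congr (V (Rel _ _)); apply/ffunP => j; rewrite !ffunE teval_term_model.
Qed.

Lemma qeval_relvars (M : model) (e : nat -> domain M) n j f :
  qeval (aeval e) (relvars n j f) = rel_interp j [ffun i : 'I_n => e (f i)].
Proof.
by congr rel_interp; apply/ffunP => i; rewrite !ffunE.
Qed.

(** * Copycat plays satisfy the matrix *)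

Lemma depth_leq (T : totree) (k : nat) (v : node T) :
  leaves_at_depth T k -> depth v <= k.
Proof.
move=> hT; have [l lf /size_prefix] := leaf_below v.
by rewrite -/(depth l) (hT l lf).
Qed.

Lemma depth_internal (T : totree) (k : nat) (u v : node T) :
  leaves_at_depth T k -> parent v = Some u -> depth u < k.
Proof. by move=> hT /depth_child <-; apply: depth_leq. Qed.

(* [a i] is Teacher's answer at the node u_i. *)
Definition copycat_play (T : totree) (A : Type) (a : nat -> A) (v : node T) : seq A :=
  a 0 :: moves (fun w : node T => a w.-1) (fun w : node T => a w) (path_to v).

Lemma size_copycat_play (T : totree) (A : Type) (a : nat -> A) (v : node T) :
  size (copycat_play a v) = (depth v).*2.+1.
Proof. by rewrite /= size_moves. Qed.

(** The values for z. The final answer is listed twice, to match the argument layout of [state]. *)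
Definition answers (T : totree) (A : Type) (a : nat -> A) : seq A :=
  [seq a i | i <- rcons (iota 0 (nedges T).+1) (nedges T)].

Lemma size_answers (T : totree) (A : Type) (a : nat -> A) :
  size (answers T a) = (nedges T).+2.
Proof. by rewrite size_map size_rcons size_iota. Qed.

Lemma nth_answers (T : totree) (A : Type) (a : nat -> A) b0 i :
  i < (nedges T).+1 -> nth b0 (answers T a) i = a i.
Proof.
move=> iT; rewrite /answers map_rcons nth_rcons size_map size_iota iT.
by rewrite (nth_map 0) ?size_iota // nth_iota.
Qed.

Lemma nth_answers_last (T : totree) (A : Type) (a : nat -> A) b0 :
  nth b0 (answers T a) (nedges T).+1 = a (nedges T).
Proof.
by rewrite /answers map_rcons nth_rcons size_map size_iota ltnn eqxx.
Qed.

Lemma nth_prefix_last (T : totree) (v l : node T) (i : nat) w0 :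
  prefix (path_to v) (path_to l) -> depth v = i.+1 -> 
  i < depth l /\ nth w0 (path_to l) i = v.
Proof.
rewrite /depth => /prefixP[s ->] dv; have [_] := path_to_path v.
rewrite (last_nth w0) size_cat dv /= => nv.
by rewrite addSn ltnS leq_addr nth_cat dv leqnn.
Qed.

(** The model is arbitrary so that the term model of a valuation yields the tautology of (a), and
    every other model yields validity. The leaf is chosen below the first node u_j at which Q_j
    fails. *)
Lemma copycat_wins (k : nat) (T : totree) (M : model) (a : nat -> domain M)
    (d0 : nat -> domain M) :
  leaves_at_depth T k ->
  exists2 l : node T, leaf l &
    qeval (aeval (fun x => nth (d0 x) (copycat_play a l ++ answers T a) x))
      (copycat_matrix k T).
Proof.
move=> hT; set n := nedges T.
pose Q j x := @rel_interp M n.+2 j [ffun i : 'I_n.+2 => if i == n.+1 :> nat then x else a i].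
pose e (l : node T) x := nth (d0 x) (copycat_play a l ++ answers T a) x.
have ez (l : node T) i : leaf l -> i < n.+1 -> e l (zvar k i) = a i.
  move=> lf ilt; rewrite /e nth_cat size_copycat_play (hT l lf) ltnNge leq_addr /=.
  by rewrite addKn nth_answers.
have ezn (l : node T) : leaf l -> e l (zvar k n.+1) = a n.
  move=> lf; rewrite /e nth_cat size_copycat_play (hT l lf) ltnNge leq_addr /=.
  by rewrite addKn nth_answers_last.
have ey (v l : node T) : prefix (path_to v) (path_to l) -> e l (depth v).*2 = a v.
  move=> vl; case Ed: (depth v) => [|d].
    rewrite /e /=; suff -> : v = ord0 by [].
    move: Ed; rewrite /depth; have [_] := path_to_path v.
    by case: (path_to v).
  have [dl nv] := nth_prefix_last (root T) vl Ed.
  by rewrite /e /= (nth_moves_odd _ _ _ _ (root T)) // nv.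
have ex (v l : node T) d : prefix (path_to v) (path_to l) -> depth v = d.+1 ->
    e l d.*2.+1 = a v.-1.
  move=> vl Ed; have [dl nv] := nth_prefix_last (root T) vl Ed.
  by rewrite /e /= (nth_moves_even _ _ _ _ (root T)) // nv.
have eQ (l : node T) j f x : leaf l -> 
    (forall i, i < n.+1 -> e l (f i) = a i) ->
    qeval (aeval (e l)) (state T j f x) = Q j (e l x).
  move=> lf fa; rewrite qeval_relvars /Q; congr rel_interp; apply/ffunP => i.
  rewrite !ffunE /update; case: eqP => // /eqP ni; apply: fa.
  by rewrite ltn_neqAle ni -ltnS ltn_ord.
(* If Q_n holds of all the answers, the first disjunct is true at any leaf. *)
have [Qn|nQn] := boolP (Q n (a n)).
  have [l lf _] := leaf_below (root T); exists l => //.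
  rewrite qeval_copycat_matrix qeval_relvars; apply/orP; left.
  move: Qn; rewrite /Q; set g := finfun _; set g' := finfun _; suff -> : g = g' by [].
  apply/ffunP => i; rewrite !ffunE.
  case: eqP => [->|/eqP ni]; first exact/esym/ezn.
  by apply/esym/ez; rewrite // ltn_neqAle ni -ltnS ltn_ord.
have exn : exists j, (j <= n) && ~~ Q j (a j) by exists n; rewrite leqnn.
case: (ex_minnP exn) => j /andP[jn nQj] minj.
pose v : node T := inord j.
have vj : v = j :> nat by rewrite inordK.
have [l lf vl] := leaf_below v; exists l => //.
rewrite qeval_copycat_matrix -/(e l); apply/orP; right.
apply/existsP; exists v; rewrite /clause.
case E: (parent v) => [u|].
  have uv := parent_lt E.
  have ul : prefix (path_to u) (path_to l).
    by apply: prefix_trans vl; rewrite (path_to_rcons E) prefix_rcons.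
  have zu i : i < n.+1 -> e l (update (zvar k) u (depth u).*2 i) = a i.
    by rewrite /update => ilt; case: eqP => [->|_]; [exact: ey | exact: ez].
  have qevalAN q1 q2 W : qeval W (QAnd q1 (QNot q2)) = qeval W q1 && ~~ qeval W q2 by [].
  have zuv i : i < n.+1 ->
      e l (update (update (zvar k) u (depth u).*2) v (depth v).*2 i) = a i.
    by rewrite {1}/update => ilt; case: eqP => [->|_]; [exact: ey | exact: zu].
  rewrite qevalAN (eQ _ _ _ _ lf zu) [X in ~~ X](eQ _ _ _ _ lf zuv).
  rewrite (ey v l) // (ex v l) ?(depth_child E) // vj nQj andbT.
  (* Had Q_{j-1} failed too, minimality would give j <= j - 1, which is impossible since [v] has a
     parent and so j > 0. *)
  apply: contraT => nQ; have /minj : (j.-1 <= n) && ~~ Q j.-1 (a j.-1).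
    by rewrite nQ (leq_trans (leq_pred _)).
  by move: uv; rewrite vj; case: (j) => // i _; rewrite ltnn.
have v0 : v = root T by apply/eqP; rewrite -parent_root E.
have j0 : j = 0 by rewrite -vj v0.
have z0 i : i < n.+1 -> e l (update (zvar k) 0 0 i) = a i.
  by rewrite /update => ilt; case: eqP => [->|_]; [|exact: ez].
have qevalN q W : qeval W (QNot q) = ~~ qeval W q by [].
rewrite qevalN (eQ _ _ _ _ lf z0).
by move: nQj; rewrite j0.
Qed.

(** * The variables of the matrix are all bound by the prefix *)

Lemma qoccurs_relvars x n j f :
  qoccurs x (relvars n j f) = [exists i : 'I_n, x == f i].
Proof. by apply: eq_existsb => i; rewrite ffunE. Qed.

Lemma qoccurs_disjunction x s : qoccurs x (disjunction s) = has (qoccurs x) s.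
Proof. by elim: s => //= q s ->. Qed.

Lemma update_ltn f c y (b n : nat) :
  y < b -> (forall i, i < n -> f i < b) -> forall i, i < n -> update f c y i < b.
Proof. by move=> yb fb i iT; rewrite /update; case: eqP => // _; apply: fb. Qed.

Lemma copycat_matrix_closed (k : nat) (T : totree) :
  leaves_at_depth T k -> matrix_closed k (nedges T).+2 (copycat_matrix k T).
Proof.
move=> hT x; set b := k.*2.+1 + _.
have bound j n f : (forall i, i < n -> f i < b) ->
    qoccurs x (relvars n j f) -> x < b.
  by move=> fb; rewrite qoccurs_relvars => /existsP[i /eqP->]; apply: fb.
have zb i : i < (nedges T).+2 -> zvar k i < b by rewrite ltn_add2l.
have db (v : node T) : (depth v).*2 < b.
  by rewrite /b addSn ltnS (leq_trans _ (leq_addr _ _)) // leq_double depth_leq.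
case/orP; first exact: (bound (nedges T)).
change (qoccurs x (disjunction [seq clause k v | v <- enum (node T)]) -> x < b).
rewrite qoccurs_disjunction has_map => /hasP[v _] /=.
rewrite /clause; case E: (parent v) => [u|]; last first.
  have b0 : 0 < b by [].
  by apply: (bound 0); apply: update_ltn => //; apply: update_ltn.
have dub : (depth u).*2.+1 < b.
  rewrite /b addSn ltnS (leq_trans _ (leq_addr _ _)) // ltn_double.
  exact: depth_internal hT E.
have zub := update_ltn u (db u) zb.
by case/orP; [apply: (bound v.-1) | apply: (bound v)]; apply: update_ltn => //; apply: update_ltn.
Qed.

(** * Validity of the formula *)

Definition env (A : Type) (e : nat -> A) (s : seq A) : nat -> A :=
  fun x => nth (e x) s x.

(** Since bound variables are numbered by position, interpreting the next quantifier appends one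
    value to the list of moves. *)
Lemma update_env (A : Type) (e : nat -> A) (s : seq A) (d : A) :
  update (env e s) (size s) d = env e (rcons s d).
Proof.
apply: functional_extensionality => x; rewrite /update /env nth_rcons.
by case: ltngtP => // xs; rewrite nth_default // ltnW.
Qed.

Lemma sat_exists (M : model) (e : nat -> domain M) (phi : qform) (s zs : seq (domain M)) :
  qeval (aeval (env e (s ++ zs))) phi ->
  sat (env e s) (foldr Ex (Matrix phi) (iota (size s) (size zs))).
Proof.
elim: zs s => [|z zs IHzs] s /=; first by rewrite cats0.
by rewrite -cat_rcons => /IHzs; rewrite size_rcons -update_env; exists z.
Qed.

(* [s] lists the values of the first variables of the prefix; Teacher can
   still win from this position. *)
Definition refuted (k m : nat) (phi : qform) (M : model) (e : nat -> domain M)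
    (s : seq (domain M)) : Prop :=
  ~ sat (env e s) (foldr quantify (foldr Ex (Matrix phi) (iota k.*2.+1 m))
                     (iota (size s) (k.*2.+1 - size s))).

Lemma refuted_forall (k m : nat) (phi : qform) (M : model) (e : nat -> domain M) s :
  ~~ odd (size s) -> size s < k.*2.+1 -> refuted k m phi e s ->
  exists y, refuted k m phi e (rcons s y).
Proof.
rewrite /refuted => ev lt; rewrite -(subnSK lt) /= => ns.
apply: NNPP => ny; apply: ns; rewrite /quantify (negPf ev) => y.
apply: NNPP; rewrite update_env => nsy; apply: ny; exists y.
by rewrite size_rcons.
Qed.

Lemma refuted_exists (k m : nat) (phi : qform) (M : model) (e : nat -> domain M) s x :
  odd (size s) -> size s < k.*2.+1 -> refuted k m phi e s ->
  refuted k m phi e (rcons s x).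
Proof.
rewrite /refuted => od lt; rewrite -(subnSK lt) /= => ns.
rewrite size_rcons => nsx; apply: ns; rewrite /quantify od; exists x.
by rewrite update_env.
Qed.

Lemma refuted_matrix (k m : nat) (phi : qform) (M : model) (e : nat -> domain M) s zs :
  size s = k.*2.+1 -> size zs = m -> refuted k m phi e s ->
  ~ qeval (aeval (env e (s ++ zs))) phi.
Proof.
rewrite /refuted => sk zm; rewrite sk subnn /= => ns ezs; apply: ns.
by rewrite -sk -zm; apply: sat_exists.
Qed.

Lemma copycat_play_child (T : totree) (A : Type) (a : nat -> A) (u v : node T) :
  parent v = Some u ->
  copycat_play a v = rcons (rcons (copycat_play a u) (a v.-1)) (a v).
Proof.
move=> E; rewrite /copycat_play (path_to_rcons E) moves_rcons.
by rewrite -!cats1 -catA.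
Qed.

Lemma eq_copycat_play (T : totree) (A : Type) (a b : nat -> A) (v : node T) :
  (forall i, i <= v -> a i = b i) -> copycat_play a v = copycat_play b v.
Proof.
move=> ab; rewrite /copycat_play ab // /moves; congr (_ :: flatten _).
apply/eq_in_map => w /path_to_leq wv.
by rewrite !ab // (leq_trans (leq_pred _)).
Qed.

(** If the formula failed in [M], Teacher could answer at u_0, u_1, ... in turn against copycat
    play, keeping the position at each node refuted. [copycat_wins] then gives a leaf where the
    matrix holds with the answers as z, a contradiction. *)
Lemma copycat_valid (k : nat) (T : totree) :
  leaves_at_depth T k ->
  valid (game_formula k (nedges T).+2 (copycat_matrix k T)).
Proof.
move=> hT M e; apply: NNPP => nsat; set m := (nedges T).+2 in nsat.
pose bad := refuted k m (copycat_matrix k T) e.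
have env_nil : env e [::] = e.
  by apply: functional_extensionality => x; rewrite /env nth_nil.
have bad0 : bad [::] by rewrite /bad /refuted subn0 env_nil.
have exa j : exists a : nat -> domain M, forall v : node T, v <= j -> bad (copycat_play a v).
  elim: j => [|j [a bad_a]].
    have [//|//|y bady] := refuted_forall _ _ bad0.
    exists (fun=> y) => v; rewrite leqn0 => /eqP v0.
    by have -> : v = root T; [exact: val_inj | rewrite /copycat_play path_to_root].
  have [jT|] := ltnP j.+1 (nedges T).+1; last first.
    by move=> Tj; exists a => v _; apply: bad_a; rewrite -ltnS (leq_trans (ltn_ord v)).
  pose v : node T := Ordinal jT.
  case E: (parent v) => [u|]; last first.
    by have := parent_root v; rewrite E eqxx => /esym/eqP/(congr1 val).
  have uj : u <= j by have := parent_lt E.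
  have du : size (copycat_play a u) < k.*2.
    by rewrite size_copycat_play ltn_Sdouble (depth_internal hT E).
  have odd_u : odd (size (copycat_play a u)) by rewrite size_copycat_play /= odd_double.
  (* Student copies [a j], the answer at the preceding node u_j, even when the parent [u] of [v] is
     an earlier node. *)
  have bad_x := refuted_exists (x := a j) odd_u (ltnW du) (bad_a u uj).
  have [||y bad_y] := refuted_forall _ _ bad_x.
  - by rewrite size_rcons /= negbK.
  - by rewrite size_rcons.
  (* Plays ending at u_j or earlier never read index [j.+1], so the new answer leaves them
     unchanged. *)
  exists (update a j.+1 y) => w; rewrite leq_eqVlt => /predU1P[wj|wj].
    have -> : w = v by apply: val_inj.
    rewrite (copycat_play_child _ E) (@eq_copycat_play _ _ _ a u) => [|i iu].
      by rewrite /update eqxx /= ltn_eqF.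
    by rewrite /update ltn_eqF // ltnS (leq_trans iu).
  rewrite (@eq_copycat_play _ _ _ a) //; first exact: bad_a.
  by move=> i iw; rewrite /update; case: eqP => // ij; rewrite ij leqNgt wj in iw.
have [a bad_a] := exa (nedges T).
have [l lf] := copycat_wins a e hT.
apply: (@refuted_matrix k m); rewrite ?size_answers // ?size_copycat_play ?hT //.
by apply: bad_a; rewrite -ltnS.
Qed.

(** * The tree with one new leaf below each leaf *)

(** Old nodes form the initial segment of the ordinals and the new leaves, indexed by the leaves of
    [T], the final one; so new leaves follow old nodes automatically. *)
Definition extended_parent (T : totree) (v : 'I_((nedges T).+1 + #|@leaf T|)) :
    option 'I_((nedges T).+1 + #|@leaf T|) :=
  match split v with
  | inl u => omap (lshift _) (parent u)
  | inr i => Some (lshift _ (enum_val i))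
  end.

Lemma extended_parent_root (T : totree) v :
  (@extended_parent T v == None) = (v == ord0 :> 'I_((nedges T).+1 + #|@leaf T|)).
Proof.
rewrite /extended_parent -(splitK v); case: (split v) => [u|i]; rewrite unsplitK /=.
  by rewrite -[RHS]/(u == ord0) -parent_root; case: (parent u).
by [].
Qed.

Lemma extended_parent_lt (T : totree) u v :
  @extended_parent T v = Some u -> u < v.
Proof.
rewrite /extended_parent -(splitK v); case: (split v) => [w|i]; rewrite unsplitK /=.
  by case E: (parent w) => [w'|] //= [<-]; apply: parent_lt E.
by case=> <- /=; apply: ltn_addr; apply: ltn_ord.
Qed.

Definition extended_tree (T : totree) : totree :=
  @TOTree (nedges T + #|@leaf T|) (@extended_parent T)
    (@extended_parent_root T) (@extended_parent_lt T).

Definition old_node (T : totree) (u : node T) : node (extended_tree T) :=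
  lshift #|@leaf T| u.

Definition new_leaf (T : totree) (i : 'I_#|@leaf T|) : node (extended_tree T) :=
  rshift (nedges T).+1 i.

Lemma parent_old (T : totree) (u : node T) :
  parent (old_node u) = omap (@old_node T) (parent u).
Proof. by rewrite /= /extended_parent (unsplitK (inl u)). Qed.

Lemma parent_new (T : totree) (i : 'I_#|@leaf T|) :
  parent (new_leaf i) = Some (old_node (enum_val i)).
Proof. by rewrite /= /extended_parent (unsplitK (inr i)). Qed.

Variant extended_node_spec (T : totree) : node (extended_tree T) -> Type :=
  | OldNode u : extended_node_spec (old_node u)
  | NewLeaf i : extended_node_spec (new_leaf i).

Lemma extended_nodeP (T : totree) (v : node (extended_tree T)) : extended_node_spec v.
Proof.
rewrite -(@splitK (nedges T).+1 #|@leaf T| v).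
by case: (split _) => [u|i]; [apply: OldNode | apply: NewLeaf].
Qed.

Lemma old_node_inj (T : totree) : injective (@old_node T).
Proof. exact: lshift_inj. Qed.

Lemma old_lt_new (T : totree) (u : node T) (i : 'I_#|@leaf T|) : old_node u < new_leaf i.
Proof. by rewrite /= ltn_addr. Qed.

Lemma old_neq_new (T : totree) (u : node T) (i : 'I_#|@leaf T|) :
  old_node u <> new_leaf i.
Proof. by move=> E; have := old_lt_new u i; rewrite E ltnn. Qed.

Lemma child_old (T : totree) (u v : node T) :
  child (old_node u) (old_node v) = child u v.
Proof.
by rewrite /child parent_old; case: (parent u).
Qed.

Lemma leaf_index (T : totree) (l : node T) :
  leaf l -> exists i : 'I_#|@leaf T|, enum_val i = l.
Proof.
move=> lf; have lfA : l \in @leaf T by [].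
by exists (enum_rank_in lfA l); rewrite enum_rankK_in.
Qed.

Lemma leaf_old (T : totree) (u : node T) : leaf (old_node u) = false.
Proof.
apply/negbF/existsP; have [lf|/negPn/existsP[v uv]] := boolP (leaf u); last first.
  by exists (old_node v); rewrite child_old.
have [i iu] := leaf_index lf.
by exists (new_leaf i); rewrite /child parent_new iu.
Qed.

Lemma leaf_new (T : totree) (i : 'I_#|@leaf T|) : leaf (new_leaf i).
Proof.
apply/existsP => -[v]; rewrite /child; case: (extended_nodeP v) => [u|j].
  by rewrite parent_old; case: (parent u) => // w /eqP/Some_inj E; case: (old_neq_new E).
by rewrite parent_new => /eqP/Some_inj E; case: (old_neq_new E).
Qed.

Lemma extended_adds_leaf_edges (T : totree) :
  adds_leaf_edges T (extended_tree T).
Proof.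
exists (@old_node T); split.
- split=> //; [exact: old_node_inj | exact: val_inj|].
  by move=> u v; rewrite child_old.
- move=> l lf; have [i il] := leaf_index lf; exists (new_leaf i); split.
    by rewrite /child parent_new il.
  move=> w; rewrite /child; case: (extended_nodeP w) => [u|j].
    rewrite parent_old; case E: (parent u) => [v|] //= /eqP/Some_inj/old_node_inj vl.
    by case/negP: lf; apply/existsP; exists u; rewrite /child E vl.
  rewrite parent_new => /eqP/Some_inj/old_node_inj jl; congr new_leaf.
  by apply: enum_val_inj; rewrite il jl.
- move=> w; case: (extended_nodeP w) => [u|i] nold; first by case: (nold u).
  exists (enum_val i); first exact: (enum_valP i).
  by rewrite /child parent_new.
- move=> w; case: (extended_nodeP w) => [u|i] nold u'; first by case: (nold u).
  exact: old_lt_new.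
Qed.

Lemma path_to_old (T : totree) (v : node T) :
  path_to (old_node v) = map (@old_node T) (path_to v).
Proof.
have [n] := ubnP (v : nat); elim: n v => // n IHn v vn.
rewrite path_toE parent_old [in RHS]path_toE; case E: (parent v) => [u|] //=.
by rewrite map_rcons IHn // (leq_trans (parent_lt E)).
Qed.

Lemma path_to_new (T : totree) (i : 'I_#|@leaf T|) :
  path_to (new_leaf i) = rcons (map (@old_node T) (path_to (enum_val i))) (new_leaf i).
Proof. by rewrite (path_to_rcons (parent_new i)) path_to_old. Qed.

(** * The winning copycat strategy *)

(** Teacher's variable at u_i will be number i, so [Var v.-1] is the variable most recently
    played. *)
Definition copycat_labeling (T : totree) : labeling (extended_tree T) (nedges T).+2 :=
  Labeling (fun v : node (extended_tree T) => Var v.-1)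
    (fun _ => @Tuple _ _ (answers T Var) (introT eqP (size_answers T Var))).

Lemma play_copycat (T : totree) (i : 'I_#|@leaf T|) :
  play (fun v => v : nat) (copycat_labeling T) (new_leaf i) =
  copycat_play Var (enum_val i : node T) ++ answers T Var.
Proof.
rewrite /play /copycat_play path_to_new filter_rcons leaf_new /=.
congr (_ :: _ ++ _); rewrite filter_map -map_comp.
rewrite (eq_filter (a2 := predT)) ?filter_predT //.
by move=> u /=; rewrite leaf_old.
Qed.

Lemma answers_allowed (T : totree) (v : node (extended_tree T)) (x i : nat) :
  leaf v -> i < (nedges T).+2 -> occurs x (nth (Var 0) (answers T Var) i) ->
  exists u : node (extended_tree T), [/\ u < v, ~~ leaf u & u = x :> nat].
Proof.
case: (extended_nodeP v) => [w|j _]; first by rewrite leaf_old.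
have old y : y < (nedges T).+1 -> occurs x (Var y) ->
    exists u : node (extended_tree T), [/\ u < new_leaf j, ~~ leaf u & u = x :> nat].
  move=> yT /= /eqP->; exists (old_node (Ordinal yT : node T)).
  by rewrite leaf_old old_lt_new.
rewrite ltnS leq_eqVlt => /predU1P[->|iT].
  by rewrite nth_answers_last; apply: old.
by rewrite nth_answers //; apply: old.
Qed.

Lemma copycat_extended (k : nat) (T : totree) :
  leaves_at_depth T k ->
  [/\ game_tree k (fun v : node (extended_tree T) => v : nat),
      strategy (fun v : node (extended_tree T) => v : nat) (copycat_labeling T),
      winning (fun v : node (extended_tree T) => v : nat) (copycat_labeling T)
        (copycat_matrix k T)
    & copycat (fun v : node (extended_tree T) => v : nat) (copycat_labeling T)].
Proof.
move=> hT; split.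
- split.
  + move=> v; case: (extended_nodeP v) => [u|i _]; first by rewrite leaf_old.
    rewrite /depth path_to_new size_rcons size_map; congr _.+1.
    exact/hT/(enum_valP i).
  + by move=> u v _ _ /val_inj.
  + move=> u v; case: (extended_nodeP u) => [u'|i]; last by rewrite leaf_new.
    case: (extended_nodeP v) => [v'|i] _; first by rewrite leaf_old.
    by rewrite old_lt_new.
- split.
  + move=> v; case: (extended_nodeP v) => [u|i]; last by rewrite leaf_new.
    move=> _ u0 x /= /eqP->.
    have u_gt0 : 0 < u by rewrite lt0n; apply: contra_notN u0 => /eqP u0; apply: val_inj.
    have uT : u.-1 < (nedges T).+1 by rewrite (leq_ltn_trans (leq_pred _)).
    exists (old_node (Ordinal uT : node T)); split; rewrite ?leaf_old //=.
    by rewrite prednK.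
  + move=> v lf j x; rewrite (tnth_nth (Var 0)) => xj.
    exact: answers_allowed lf (ltn_ord j) xj.
  (* Siblings are not the root, and the predecessor is injective on positive numbers. *)
  + move=> u v w uv wv vw _ _ /= [] /eqP; rewrite -eqSS !prednK.
    * by move/eqP/val_inj.
    * by apply: leq_ltn_trans (parent_lt (eqP wv)).
    * by apply: leq_ltn_trans (parent_lt (eqP uv)).
  (* Each old leaf receives a single new child, so two distinct leaves are never siblings. *)
  + move=> u v w; case: (extended_nodeP v) => [v'|i]; first by rewrite leaf_old.
    case: (extended_nodeP w) => [w'|j]; first by rewrite leaf_old.
    rewrite /child !parent_new => /eqP/Some_inj <- /eqP/Some_inj/old_node_inj/enum_val_inj ->.
    by [].
- move=> V; rewrite qeval_disjunction.
  have [l lf wl] := copycat_wins (M := term_model V) Var Var hT.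
  have [i il] := leaf_index lf; apply/existsP; exists (new_leaf i).
  apply/andP; split; first exact: leaf_new.
  by rewrite /instance qeval_qsubst play_copycat il; apply: wl.
- by move=> u v vu _ /=; rewrite vu.
Qed.

(** * The valuation by partial copycat embeddings *)

Definition is_var (x : nat) (t : term) : bool :=
  if t is Var y then y == x else false.

Lemma is_varP (x : nat) (t : term) : reflect (t = Var x) (is_var x t).
Proof.
case: t => [y|n i a] /=; last by constructor.
by apply: (iffP eqP) => [->|[]].
Qed.

(* [tau] embeds the subtree {u_0, ..., u_j} of [T] as a copycat play. *)
Definition partial_copycat (T T' : totree) (m : nat) (y : node T' -> nat)
    (S : labeling T' m) (j : nat) (tau : {ffun node T -> node T'}) : bool :=
  (tau (root T) == root T') &&
  [forall v : node T, (v <= j) ==> ~~ leaf (tau v) &&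
     (if parent v is Some u then
        [&& child (tau v) (tau u),
            is_var (y (tau (inord v.-1))) (move S (tau v))
          & tau (inord v.-1) < tau v]
      else true)].

(** The interpretation of Q_j for part (b). For [j <= nedges T], [minn q j] is [q] in the first
    [j.+1] places and [j] in the repeated last place; the places in between are left free. *)
Definition copycat_valuation (T T' : totree) (m : nat) (y : node T' -> nat)
    (S : labeling T' m) (a : atom) : bool :=
  let: Rel ar j args := a in
  [exists tau : {ffun node T -> node T'},
    partial_copycat y S j tau &&
    [forall q : 'I_ar, (q <= j) || (q == (nedges T).+1 :> nat) ==>
       is_var (y (tau (inord (minn q j)))) (args q)]].

Lemma copycat_valuationP (T T' : totree) (m : nat) (y : node T' -> nat)
    (S : labeling T' m) (s : nat -> term) (j : nat) (f : nat -> nat) (x : nat) :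
  j <= nedges T ->
  reflect (exists tau : {ffun node T -> node T'},
             [/\ partial_copycat y S j tau,
                 forall i : node T, i <= j -> s (f i) = Var (y (tau i))
               & s x = Var (y (tau (inord j)))])
    (qeval (aeval (M := term_model (copycat_valuation T y S)) s) (state T j f x)).
Proof.
move=> jT; rewrite qeval_relvars; apply: (iffP existsP) => -[tau].
  case/andP=> pc /forallP args; exists tau; split=> // [i ij|].
    have := args (widen_ord (leqnSn _) i); rewrite ffunE /= ij /=.
    rewrite /update ltn_eqF // (minn_idPl ij) inord_val.
    by move/is_varP.
  have := args ord_max; rewrite ffunE /= eqxx orbT /= /update eqxx.
  by rewrite (minn_idPr (leqW jT)) => /is_varP.
case=> pc fs xs; exists tau; rewrite pc; apply/forallP => q; apply/implyP => qj.
rewrite ffunE /update; case: eqP qj => [->|_] /=.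
  by rewrite (minn_idPr (leqW jT)) => _; apply/is_varP.
rewrite orbF => qj; apply/is_varP; rewrite (minn_idPl qj).
have qK : (inord q : node T) = q :> nat by rewrite inordK // ltnS (leq_trans qj).
by rewrite -fs qK.
Qed.

(** Growth at consecutive nodes gives strict monotonicity, hence injectivity and, the order being
    total, the equivalence of orders. Uniqueness of parents then reflects the child relation. *)
Lemma partial_copycat_embedding (T T' : totree) (m : nat) (y : node T' -> nat)
    (S : labeling T' m) (tau : {ffun node T -> node T'}) :
  partial_copycat y S (nedges T) tau ->
  embedding tau /\
  forall u v : node T, v = u.+1 :> nat -> move S (tau v) = Var (y (tau u)).
Proof.
case/andP=> /eqP tau0 /forallP pc.
have step (u v : node T) : v = u.+1 :> nat ->
    tau u < tau v /\ move S (tau v) = Var (y (tau u)).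
  move=> vu; have := pc v; rewrite -ltnS ltn_ord /=.
  case E: (parent v) => [w|]; last first.
    by have := parent_root v; rewrite E eqxx => /esym/eqP v0; rewrite v0 in vu.
  by rewrite vu /= inord_val => /and4P[_ _ /is_varP].
have lt_tau (u v : node T) : u < v -> tau u < tau v.
  case: v => v vT /=; elim: v vT => // v IHv vT; rewrite ltnS leq_eqVlt.
  have vT' := ltnW vT; have [lt_v _] := step (Ordinal vT') (Ordinal vT) erefl.
  case/predU1P=> [uv|uv]; last exact: ltn_trans (IHv vT' uv) lt_v.
  by have -> : u = Ordinal vT' by apply: val_inj.
have lt_tauE (u v : node T) : (u < v) = (tau u < tau v).
  apply/idP/idP => [|tuv]; first exact: lt_tau.
  rewrite ltnNge leq_eqVlt; apply/negP => /predU1P[/val_inj vu|/lt_tau].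
    by rewrite vu ltnn in tuv.
  by rewrite ltnNge (ltnW tuv).
have inj_tau : injective tau.
  move=> u v tuv; apply: val_inj; case: (ltngtP (u : nat) v) => //.
    by rewrite lt_tauE tuv ltnn.
  by rewrite lt_tauE tuv ltnn.
split; last by move=> u v /step[].
split=> // u v; have := pc u; rewrite -ltnS ltn_ord /= /child.
case E: (parent u) => [w|].
  case/and4P=> _ /eqP-> _ _.
  by apply/eqP/eqP => [[->]//|/Some_inj/inj_tau->].
have := parent_root u; rewrite E eqxx => /esym/eqP u0 _.
have : parent (root T') == None by rewrite parent_root.
by have u_root : u = root T := u0; rewrite -tau0 -u_root => /eqP->.
Qed.

(** * Labels along a branch of a game tree *)

Lemma filter_internal (T : totree) (v : node T) :
  ~~ leaf v -> [seq w <- path_to v | ~~ leaf w] = path_to v.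
Proof.
have [n] := ubnP (v : nat); elim: n v => // n IHn v vn.
rewrite path_toE; case E: (parent v) => [u|] // lv.
rewrite filter_rcons lv IHn //; first exact: leq_trans (parent_lt E) _.
by rewrite negbK; apply/existsP; exists v; rewrite /child E.
Qed.

Lemma parent_internal (T : totree) (u v : node T) : parent v = Some u -> ~~ leaf u.
Proof. by move=> E; rewrite negbK; apply/existsP; exists v; rewrite /child E. Qed.

(** The branch is cut at the parent of [l], of depth [k]: everything up to there is internal, so the
    play strictly alternates and [b d] is the node at depth [d]. *)
Lemma branch_play (k m : nat) (T : totree) (y : node T -> nat) (S : labeling T m)
    (l : node T) (s := fun x => nth (Var x) (play y S l) x) :
  leaves_at_depth T k.+1 -> leaf l ->
  exists b : nat -> node T,
    [/\ b 0 = root T,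
        forall d, d <= k -> ~~ leaf (b d) /\ s d.*2 = Var (y (b d))
      & forall d, d < k -> parent (b d.+1) = Some (b d) /\ s d.*2.+1 = move S (b d.+1)].
Proof.
move=> hT lf; have := hT l lf; case E: (parent l) => [p|]; last first.
  by rewrite /depth path_toE E.
rewrite (depth_child E) => -[dp].
have [/(pathP (root T)) pp lp] := path_to_path p.
pose b d := nth (root T) (root T :: path_to p) d.
have bp d : d < k -> parent (b d.+1) = Some (b d).
  by move=> dk; apply/eqP/pp; rewrite -dp in dk.
have sE : play y S l =
    Var (y (root T)) :: moves (move S) (fun v => Var (y v)) (path_to p) ++ final S l.
  rewrite /play (path_to_rcons E) filter_rcons lf /= filter_internal //.
  exact: parent_internal E.
exists b; split=> // d dk; split; rewrite ?bp //.
- have [d_lt_k|k_le_d] := ltnP d k; first exact: parent_internal (bp d d_lt_k).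
  have -> : d = k by apply/eqP; rewrite eqn_leq dk.
  rewrite /b -dp -/(size _) -(last_nth (root T)) lp.
  exact: parent_internal E.
- case: d dk => [|d] dk; first by rewrite /s sE.
  by rewrite /s sE doubleS /= (nth_moves_odd _ _ _ _ (root T)) // [size _]dp.
- by rewrite /s sE /= (nth_moves_even _ _ _ _ (root T)) // [size _]dp.
Qed.

(** * Extraction of the embedding from a winning strategy *)

(** The conditions at nodes before [v] mention only nodes before [v], so changing the value at [v]
    preserves them. *)
Lemma partial_copycat_extend (T T' : totree) (m : nat) (y : node T' -> nat)
    (S : labeling T' m) (tau : {ffun node T -> node T'}) (u v : node T) (w : node T') :
  partial_copycat y S v.-1 tau -> parent v = Some u ->
  ~~ leaf w -> child w (tau u) -> move S w = Var (y (tau (inord v.-1))) ->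
  tau (inord v.-1) < w ->
  partial_copycat y S v [ffun x => if x == v then w else tau x].
Proof.
case/andP=> tau0 /forallP pc E lw wu mw ltw.
have uv := parent_lt E; have v_gt0 : 0 < v by apply: leq_trans uv.
have small (x : node T) : x < v -> (x == v) = false.
  by move=> xv; apply/negbTE; rewrite -(inj_eq val_inj) ltn_eqF.
have pred_small (x : node T) : 0 < x -> x <= v -> (inord x.-1 == v) = false.
  move=> x_gt0 xv; apply: small.
  have xT : x.-1 < (nedges T).+1 by apply: leq_ltn_trans (leq_pred _) _.
  by rewrite inordK // prednK.
apply/andP; split; first by rewrite ffunE small.
apply/forallP => x; apply/implyP; rewrite leq_eqVlt => /predU1P[/val_inj->|xv].
  rewrite !ffunE eqxx lw E !ffunE small // wu pred_small // ltw andbT /=.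
  exact/is_varP.
have := pc x; rewrite -ltnS prednK // xv /= !ffunE small //.
case/andP=> -> /=; case Ex: (parent x) => [z|] //.
have zx := parent_lt Ex; have x_gt0 : 0 < x by apply: leq_trans zx.
by rewrite !ffunE small ?pred_small ?(ltn_trans zx) // ltnW.
Qed.

Lemma winning_copycat (k m : nat) (T T' : totree) (y : node T' -> nat) (S : labeling T' m) :
  leaves_at_depth T k -> game_tree k y -> strategy y S ->
  winning y S (copycat_matrix k T) ->
  exists tau : {ffun node T -> node T'}, partial_copycat y S (nedges T) tau.
Proof.
move=> hT [hT' y_inj _] [allowed_move _ _ _] /(_ (copycat_valuation T y S)).
rewrite qeval_disjunction => /existsP[l /andP[lf]].
rewrite /instance qeval_qsubst; set s := fun x => nth _ _ _.
have [b [b0 bE bP]] := branch_play y S hT' lf.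
rewrite qeval_copycat_matrix => /orP[|/existsP[v]].
  by rewrite qeval_relvars => /existsP[tau /andP[pc _]]; exists tau.
have qevalN q W : qeval W (QNot q) = ~~ qeval W q by [].
have qevalA q1 q2 W : qeval W (QAnd q1 q2) = qeval W q1 && qeval W q2 by [].
have vT : v <= nedges T by rewrite -ltnS.
rewrite /clause; case E: (parent v) => [u|]; last first.
  (* The root clause denies Q_0 of Teacher's first move, but a constant map witnesses it: for j = 0
     only u_0 is constrained. *)
  rewrite qevalN => /copycat_valuationP[] //; exists [ffun=> root T'].
  have [lb0 s0] := bE 0 (leq0n k); rewrite b0 in lb0 s0.
  split=> [|i|].
  - apply/andP; split; first by rewrite ffunE.
    apply/forallP => i; apply/implyP; rewrite leqn0 ffunE lb0 => /eqP i0.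
    have /eqP-> // : parent i == None; rewrite parent_root; exact/eqP/val_inj.
  - by rewrite leqn0 => /eqP->; rewrite ffunE.
  - by rewrite ffunE.
have v1T : v.-1 <= nedges T := leq_trans (leq_pred _) vT.
rewrite qevalA qevalN => /andP[/(copycat_valuationP _ _ _ _ _ v1T)[tau [pc fs mv]]].
(* The clause also denies Q_v; extending [tau] by the node of the branch one level below
   [b (depth u)] shows that Q_v holds. *)
case/(copycat_valuationP _ _ _ _ _ vT).
have uv := parent_lt E; have v_gt0 : 0 < v by apply: leq_trans uv.
have dk : depth u < k := depth_internal hT E.
have [lbd sd] := bE _ (ltnW dk); have [pbd md] := bP _ dk; have [lbSd sSd] := bE _ dk.
have uv1 : u <= v.-1 by rewrite -ltnS prednK.
have internal (i : node T) : i <= v.-1 -> ~~ leaf (tau i).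
  by case/andP: pc => _ /forallP/(_ i)/implyP H /H/andP[].
(* y_{d-1} stands in the place of [u], and Teacher's variables are distinct. *)
have tau_u : tau u = b (depth u).
  apply: y_inj; rewrite ?internal //; have := fs u uv1.
  by rewrite /update eqxx [LHS]sd => -[].
have mvE : move S (b (depth u).+1) = Var (y (tau (inord v.-1))) by rewrite -md.
have v1K : (inord v.-1 : node T) = v.-1 :> nat by rewrite inordK.
(* A move may only use variables of earlier nodes, and distinctness identifies the node carrying
   this one; hence the order is preserved. *)
have lt_b : tau (inord v.-1) < b (depth u).+1.
  have nroot : b (depth u).+1 <> root T'.
    by move=> r; have := parent_root (b (depth u).+1); rewrite r eqxx -r pbd.
  have [|w [wb lw yw]] := allowed_move _ lbSd nroot (y (tau (inord v.-1))).
    by rewrite mvE /= eqxx.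
  by rewrite -(y_inj w (tau (inord v.-1))) // internal // v1K.
exists [ffun x => if x == v then b (depth u).+1 else tau x]; split.
- by apply: partial_copycat_extend pc E _ _ _ _; rewrite // /child tau_u pbd.
- move=> i; rewrite ffunE {1}/update leq_eqVlt => /predU1P[/val_inj->|iv].
    by rewrite !eqxx (depth_child E).
  rewrite -(inj_eq val_inj) ltn_eqF //; apply: fs.
  by rewrite -ltnS prednK.
- by rewrite inord_val ffunE eqxx (depth_child E).
Qed.

Theorem theorem3p1 (k : nat) (hk : 1 <= k) (T : totree)
    (hT : leaves_at_depth T k) :
  exists (m : nat) (phi : qform),
    [/\ matrix_closed k m phi,
        valid (game_formula k m phi),
        exists (Ts : totree) (y : node Ts -> nat) (S : labeling Ts m),
          [/\ adds_leaf_edges T Ts, game_tree k y, strategy y S,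
              winning y S phi & copycat y S]
      & forall (T' : totree) (y' : node T' -> nat) (S' : labeling T' m),
          game_tree k y' -> strategy y' S' -> winning y' S' phi ->
          exists tau : node T -> node T',
            embedding tau /\
            forall u v : node T, v = u.+1 :> nat ->
              move S' (tau v) = Var (y' (tau u))].
Proof.
exists (nedges T).+2, (copycat_matrix k T); split.
- exact: copycat_matrix_closed.
- exact: copycat_valid.
- exists (extended_tree T), (fun v : node (extended_tree T) => v : nat),
    (copycat_labeling T).
  have [gt st win cc] := copycat_extended hT.
  by split=> //; apply: extended_adds_leaf_edges.
- move=> T' y' S' gt st win; have [tau pc] := winning_copycat hT gt st win.
  by exists tau; apply: partial_copycat_embedding.
Qed.
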